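(* Let $k$ be a field of characteristic different from $2$, and let $t\in k$ with $t\neq 0$ and $t^2\ne 1$. Let $E$ be the projective Edwards curve attached to $(k,t)$, with the addition $\oplus$ (both as defined in the context). Then $E$ is an abelian group under $\oplus$.
   Context: Let $e(x,y)=x^2+y^2-1-t^2x^2y^2$, let $E_{\mathrm{aff}}=\{(x,y)\in k^2\mid e(x,y)=0\}$, and let $E^\circ=\{(x,y)\in E_{\mathrm{aff}}\mid x\neq 0,\ y\ne 0\}$. Define $\tau(x,y)=(1/(tx),1/(ty))$, which is an involution of $E^\circ$, and $\iota(x,y)=(x,-y)$. For $P=(x_1,y_1)$ and $Q=(x_2,y_2)$ in $E_{\mathrm{aff}}$ set $$\delta_0(P,Q)=(1-t^2x_1x_2y_1y_2)(1+t^2x_1x_2y_1y_2),\qquad \delta_1(P,Q)=(x_2y_1-x_1y_2)(x_1x_2+y_1y_2),$$ and define $$P\oplus_0Q=\left(\frac{x_1x_2-y_1y_2}{1-t^2x_1x_2y_1y_2},\frac{x_1y_2+y_1x_2}{1+t^2x_1x_2y_1y_2}\right)\ \text{ when } \delta_0(P,Q)\neq0,$$ $$P\oplus_1Q=\left(\frac{x_1y_1-x_2y_2}{x_2y_1-x_1y_2},\frac{x_1y_1+x_2y_2}{x_1x_2+y_1y_2}\right)\ \text{ when } \delta_1(P,Q)\neq0.$$ The projective Edwards curve $E$ is the quotient of two copies of $E_{\mathrm{aff}}$, i.e. of $E_{\mathrm{aff}}\times \mathbb{F}_2$ with $\mathbb{F}_2=\mathbb{Z}/2\mathbb{Z}$,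 by the gluing relation $(P,i)\sim(\tau P,i+1)$ for $P\in E^\circ$, $i\in\mathbb{F}_2$. Write $[P,i]\in E$ for the class of $(P,i)$. Addition on $E$ is given by the rule $$[P,i]\oplus[Q,j]=[P\oplus_\ell Q,\ i+j]\quad\text{if }\delta_\ell(P,Q)\neq0,\ \ \ell\in\mathbb{F}_2,$$ where any representatives $(P,i)$, $(Q,j)$ of the two classes and any $\ell\in\mathbb F_2$ with $\delta_\ell(P,Q)\ne0$ may be used. That this rule gives a well-defined operation on all of $E\times E$ is part of the assertion that $E$ is a group. The identity element is $[(1,0),0]$ and the inverse is $[P,i]\mapsto[\iota P,i]$. *)

(* Defs.v *)
From mathcomp Require Import all_boot all_order all_algebra.
From mathcomp Require Import ring.

Set Implicit Arguments.
Unset Strict Implicit.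
Unset Printing Implicit Defensive.

Import GRing.Theory.
Local Open Scope ring_scope.
Local Open Scope quotient_scope.

Section Edwards.
Variables (k : fieldType) (t : k).
Implicit Types p q : k * k.

Definition edwards_poly (x y : k) : k :=
  x ^+ 2 + y ^+ 2 - 1 - t ^+ 2 * x ^+ 2 * y ^+ 2.

Definition Eaff := {p : k * k | edwards_poly p.1 p.2 == 0}.

Definition Ecirc : pred Eaff :=
  [pred P | ((val P).1 != 0) && ((val P).2 != 0)].

Definition tau p : k * k := (1 / (t * p.1), 1 / (t * p.2)).

Lemma one0_on_curve : edwards_poly 1 0 == 0.
Proof. by apply/eqP; rewrite /edwards_poly; ring. Qed.

Definition one0 : Eaff := exist _ (1, 0) one0_on_curve.

Lemma iota_on_curve (P : Eaff) :
  edwards_poly (val P).1 (- (val P).2) == 0.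
Proof. by case: P => -[x y] /=; rewrite /edwards_poly !sqrrN. Qed.

Definition Eiota (P : Eaff) : Eaff :=
  exist _ ((val P).1, - (val P).2) (iota_on_curve P).

Definition delta0 p q : k :=
  (1 - t ^+ 2 * p.1 * q.1 * p.2 * q.2) * (1 + t ^+ 2 * p.1 * q.1 * p.2 * q.2).

Definition delta1 p q : k :=
  (q.1 * p.2 - p.1 * q.2) * (p.1 * q.1 + p.2 * q.2).

Definition oplus0 p q : k * k :=
  ((p.1 * q.1 - p.2 * q.2) / (1 - t ^+ 2 * p.1 * q.1 * p.2 * q.2),
   (p.1 * q.2 + p.2 * q.1) / (1 + t ^+ 2 * p.1 * q.1 * p.2 * q.2)).

Definition oplus1 p q : k * k :=
  ((p.1 * p.2 - q.1 * q.2) / (q.1 * p.2 - p.1 * q.2),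
   (p.1 * p.2 + q.1 * q.2) / (p.1 * q.1 + p.2 * q.2)).

Definition delta (l : 'F_2) p q : k := if l == 0 then delta0 p q else delta1 p q.

Definition oplus (l : 'F_2) p q : k * k :=
  if l == 0 then oplus0 p q else oplus1 p q.

(* The reflexive closure of the gluing (P, i) ~ (tau P, i + 1), P in Ecirc;
   for t != 0, tau is an involution of Ecirc and i + 1 + 1 = i in 'F_2, so this
   is already the equivalence relation generated by the gluing.  For t = 0 the
   junk value tau p = (0, 0) is off the curve and nothing is glued. *)
Definition glue (u v : Eaff * 'F_2) : bool :=
  (u == v) || [&& Ecirc u.1, val v.1 == tau (val u.1) & v.2 == u.2 + 1].

Lemma tauK (P Q : Eaff) :
  Ecirc P -> val Q = tau (val P) -> Ecirc Q /\ tau (val Q) = val P.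
Proof.
rewrite /Ecirc /= => /andP[x0 y0] QE; have := valP Q; rewrite /= QE.
case: (val P) x0 y0 {QE} => x y /= x0 y0 e0; have t0 : t != 0.
  apply: contraL e0 => /eqP ->; rewrite !mul0r invr0 mulr0.
  have -> : edwards_poly 0 0 = - 1 by rewrite /edwards_poly; ring.
  by rewrite oppr_eq0 oner_eq0.
rewrite /tau /= !div1r !invr_eq0 !mulf_eq0 !negb_or t0 x0 y0; split=> //.
by congr (_, _); field; rewrite oner_eq0 t0 ?x0 ?y0.
Qed.

Lemma glue_is_equiv : equiv_class_of glue.
Proof.
have F2 (i : 'F_2) : i + 1 + 1 = i.
  by rewrite -addrA (_ : 1 + 1 = 0) ?addr0 //; apply/val_inj.
have sym u v : glue u v -> glue v u.
  case/orP=> [/eqP-> | ]; first by rewrite /glue eqxx.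
  move=> /and3P[Pc /eqP QE /eqP jE]; have [Qc PE] := tauK Pc QE.
  by apply/orP; right; rewrite Qc PE jE F2 !eqxx.
split.
- by move=> u; rewrite /glue eqxx.
- by move=> u v; apply/idP/idP; apply: sym.
move=> v u w uv vw; move: (uv) (vw); rewrite {1}/glue => /orP[/eqP-> //|].
move=> /and3P[_ /eqP E /eqP Ei]; rewrite {1}/glue => /orP[/eqP<- //|].
move=> /and3P[_ /eqP E' /eqP Ei']; move: (sym _ _ uv).
rewrite {1}/glue => /orP[/eqP vu|]; first by rewrite -vu.
move=> /and3P[_ /eqP F _].
rewrite /glue; apply/orP; left; apply/eqP.
case: u w E F E' Ei Ei' {uv vw} => [P i] [Q j] E F E' Ei Ei'.
congr (_, _); first by apply: val_inj; exact: etrans F (esym E').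
by rewrite /= in Ei Ei'; rewrite Ei' Ei F2.
Qed.

Canonical glue_equiv := EquivRelPack glue_is_equiv.

Definition Ecurve := {eq_quot glue_equiv}.

Definition Ecls (P : Eaff) (i : 'F_2) : Ecurve := \pi_Ecurve (P, i).

(* c is one of the values the rule allows for the sum of a and b, over all
   choices of representatives and of l.  Since R ranges over Eaff, a pair
   outside the curve would give no value; oplus l (val P) (val Q) must be
   shown to lie on the curve separately. *)
Definition add_rule (a b c : Ecurve) : Prop :=
  exists (P Q R : Eaff) (i j l : 'F_2),
    [/\ a = Ecls P i, b = Ecls Q j, delta l (val P) (val Q) != 0,
        val R = oplus l (val P) (val Q) & c = Ecls R (i + j)].

End Edwards.

(* Main.v *)
Require Import Defs.
From mathcomp Require Import all_boot all_order all_algebra.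
From mathcomp Require Import ring.
Set Implicit Arguments.
Unset Strict Implicit.
Unset Printing Implicit Defensive.
Import GRing.Theory.
Local Open Scope ring_scope.

(** Why the group law holds.  In the compactification of the curve inside
P^1 x P^1, the class [P, 0] has homogeneous coordinates ((x : 1), (y : 1)) and
[P, 1] has ((1 : tx), (1 : ty)), so that the gluing by tau merely says that
these two charts overlap.  Two observations reduce everything to the first
coordinate.  The y-coordinate of a point is the x-coordinate of the point
rotated by a quarter turn ([rot]), and the rotation commutes with both addition
laws.  And the x-coordinate of P (+)_l Q is a ratio num : den of polynomials in
P and Q ([xlaw]) which remains meaningful where the division does not.

The two ratios [xlaw 0] and [xlaw 1] agree on the curve ([laws_agree]), never
degenerate to (0 : 0) together ([laws_complete]), and tau, applied to one
argument, exchanges them and switches the chart ([xlaw_tau]).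
Hence the relation [is_sum], which asks that the coordinates of the third
class be proportional to both ratios, determines the third class
([is_sum_uniq]), does not depend on representatives ([is_sum_gluel]) and
contains every instance of the addition rule ([oplus_is_sum]).  Conversely, for
any Q and any class, some representative P of this class and some law l have
delta_l(P, Q) <> 0 ([law_applies]); so the rule defines a total operation.
Both completeness statements come down to one impossible configuration, which
would give t^2 = 1 ([no_degenerate_diagonal]).

Associativity needs no study of special positions.  By [law_applies], applied
on both sides of a fixed representative Q of the middle class, the inner sums
U = P (+)_l Q and V = Q (+)_m R may be taken affine.  For the outer sums, the
ratios that law e gives for (U, R) and law f for (P, V) are proportional for
every e and f ([oplus_assoc_ratio]): sixteen polynomial identities modulo the
three curve equations.  As at least one e and one f give a nonzero vector, the
two outer sums have the same coordinates. *)

(** * Points, rotations and the two addition laws *)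

Section Laws.
Variables (k : fieldType) (t : k).
Hypotheses (char_neq2 : 2%N \notin [pchar k]) (t_neq0 : t != 0) (t2_neq1 : t ^+ 2 != 1).
Implicit Types (p q r : k * k) (a b c : k * k) (l m i j : 'F_2).

Let two_neq0 : (2%:R : k) != 0.
Proof. by move: char_neq2; rewrite inE /=. Qed.

Lemma F2_cases i : i = 0 \/ i = 1.
Proof. by case: i => -[|[|]] // ?; [left | right]; apply: val_inj. Qed.

Definition oncurve p := edwards_poly t p.1 p.2 = 0.

(** The curve equation solved for its leading term.  As t^2 is invertible,
these rewriting rules for different points, together with the rule that
cancels t^2 against its inverse, have pairwise coprime leading monomials, hence
form a Groebner basis: normalization with them reduces to 0 every polynomial
of the ideal they generate. *)
Lemma curve_rule p : oncurve p ->
  p.1 ^+ 2 * p.2 ^+ 2 = (t ^+ 2)^-1 * (p.1 ^+ 2 + p.2 ^+ 2 - 1).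
Proof.
move=> /eqP; rewrite subr_eq0 => /eqP ->; field; exact: t_neq0.
Qed.

Let t_rule : t ^+ 2 * (t ^+ 2)^-1 = 1.
Proof. by rewrite divff // sqrf_eq0. Qed.

(** Translation by (0, -1); its first coordinate is the second coordinate of
[p], and this is how statements on abscissas yield those on ordinates. *)
Definition rot p : k * k := (p.2, - p.1).

(** Homogeneous coordinates (numerator, denominator) of the abscissa of
[oplus t l p q]; they may both vanish. *)
Definition xlaw l p q : k * k :=
  if l == 0 then (p.1 * q.1 - p.2 * q.2, 1 - t ^+ 2 * p.1 * q.1 * p.2 * q.2)
  else (p.1 * p.2 - q.1 * q.2, q.1 * p.2 - p.1 * q.2).

Lemma oplus_curve l p q : oncurve p -> oncurve q -> delta t l p q != 0 ->
  oncurve (oplus t l p q).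
Proof.
(* The inverse of t^2 becomes a variable s, so that the rules are polynomial. *)
move=> /curve_rule e1 /curve_rule e2.
rewrite /delta /oplus /oncurve /edwards_poly; case: ifP => _;
  rewrite /delta0 /delta1 mulf_eq0 negb_or => /andP[d1 d2];
  move: (t ^+ 2)^-1 t_rule e1 e2 => s ts e1 e2 /=;
  (field: ts e1 e2); exact/andP.
Qed.

(** Proportionality of homogeneous coordinates; (0, 0) is proportional to
everything, which is why transitivity needs a nonzero middle term. *)
Definition same_ratio a b := a.1 * b.2 == a.2 * b.1.

(** The ordinate of the sum is the abscissa of the rotated sum, which is the sum
of the rotated first point and the second. *)
Lemma oplusE l p q :
  oplus t l p q = ((xlaw l p q).1 / (xlaw l p q).2,
                   (xlaw l (rot p) q).1 / (xlaw l (rot p) q).2).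
Proof.
rewrite /oplus /xlaw; case: ifP => _ /=; congr (_, _).
- by congr (_ / _); ring.
- by rewrite -[RHS]mulrNN -invrN; congr (_ / _); ring.
Qed.

Lemma delta_neq0 l p q :
  (delta t l p q != 0) = ((xlaw l p q).2 != 0) && ((xlaw l (rot p) q).2 != 0).
Proof.
rewrite -negb_or -mulf_eq0 /delta /delta0 /delta1 /xlaw /=.
case: ifP => _ /=; first by congr (_ * _ != 0); ring.
by rewrite -oppr_eq0 -mulrN; congr (_ * _ != 0); ring.
Qed.

Lemma rot_curve p : oncurve p -> oncurve (rot p).
Proof.
by rewrite /oncurve /edwards_poly /= => <-; ring.
Qed.

Lemma rot_oplus l p q : rot (oplus t l p q) = oplus t l (rot p) q.
Proof.
have rr : xlaw l (rot (rot p)) q = (- (xlaw l p q).1, (xlaw l p q).2)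
   \/ xlaw l (rot (rot p)) q = ((xlaw l p q).1, - (xlaw l p q).2).
  by rewrite /xlaw; case: ifP => _ /=; [left|right]; congr (_, _); ring.
rewrite !oplusE /rot /= -/(rot p) -/(rot (rot p)).
by case: rr => -> /=; rewrite ?mulNr ?invrN ?mulrN.
Qed.

Lemma delta_rot l p q : delta t l p q != 0 -> delta t l (rot p) q != 0.
Proof.
rewrite !delta_neq0 => /andP[d1 ->].
suff -> : ((xlaw l (rot (rot p)) q).2 != 0) = ((xlaw l p q).2 != 0) by [].
rewrite /xlaw; case: ifP => _ /=; first by congr (_ != 0); ring.
by rewrite -oppr_eq0; congr (_ != 0); ring.
Qed.

Lemma delta_sym l p q : (delta t l p q != 0) = (delta t l q p != 0).
Proof.
rewrite /delta /delta0 /delta1; case: ifP => _; first by congr (_ != 0); ring.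
by rewrite -oppr_eq0; congr (_ != 0); ring.
Qed.

Lemma laws_agree l m p q : oncurve p -> oncurve q ->
  same_ratio (xlaw l p q) (xlaw m p q).
Proof.
move=> /curve_rule e1 /curve_rule e2; rewrite /same_ratio /xlaw; apply/eqP.
move: (t ^+ 2)^-1 t_rule e1 e2 => s ts e1 e2.
by case: ifP => _; case: ifP => _ /=; ring: ts e1 e2.
Qed.

(** With w = x^2 = y^2 the curve equation is 2w - 1 = t^2 w^2, and the square
of the right-hand side is 1; so 4w(w - 1) = 0, hence w = 1 as w <> 0 and
2 <> 0, whence t^2 = 1. *)
Lemma no_degenerate_diagonal p : oncurve p -> p.1 ^+ 2 = p.2 ^+ 2 ->
  (t ^+ 2 * p.1 ^+ 2 * p.2 ^+ 2) ^+ 2 = 1 -> False.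
Proof.
case: p => x y; rewrite /oncurve /edwards_poly /= => cp xy; rewrite -xy in cp *.
move=> t4; move: t2_neq1; rewrite -subr_eq0 => /eqP; case.
have : 4%:R * x ^+ 2 * (x ^+ 2 - 1) = 0.
  transitivity ((2%:R * x ^+ 2 - 1 + t ^+ 2 * x ^+ 2 * x ^+ 2) *
     (x ^+ 2 + x ^+ 2 - 1 - t ^+ 2 * x ^+ 2 * x ^+ 2)
     + (t ^+ 2 * x ^+ 2 * x ^+ 2) ^+ 2 - 1); first by ring.
  by rewrite cp t4; ring.
have x0 : x != 0.
  apply/eqP => x0; move: t4; rewrite x0 => /eqP.
  by rewrite !expr0n /= mulr0 expr0n eq_sym oner_eq0.
move/eqP; rewrite (natrM _ 2 2) !mulf_eq0 (negPf two_neq0) (negPf x0) /=.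
by rewrite subr_eq0 => /eqP x1; rewrite x1 in cp; rewrite -oppr0 -cp; ring.
Qed.

(** A common zero of both ratios forces p onto a diagonal x^2 = y^2 with
t^4 x^4 y^4 = 1. *)
Lemma laws_complete p q : oncurve p -> exists l, xlaw l p q != (0, 0).
Proof.
move=> cp; case: (eqVneq (xlaw 0 p q) (0, 0)) => [|?]; last by exists 0.
case: (eqVneq (xlaw 1 p q) (0, 0)) => [|?]; last by exists 1.
rewrite /xlaw /= => -[n1 z1] [n0 z0]; case: (no_degenerate_diagonal cp).
- have : (p.1 * q.1) * (p.1 ^+ 2 - p.2 ^+ 2) = 0.
    transitivity (p.1 ^+ 2 * (p.1 * q.1 - p.2 * q.2) -
                  p.1 * p.2 * (q.1 * p.2 - p.1 * q.2)); first by ring.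
    by rewrite n0 z1; ring.
  move/eqP; rewrite mulf_eq0 subr_eq0 => /orP[/eqP pq0|/eqP //].
  move: z0; rewrite -[t ^+ 2 * p.1 * q.1]mulrA pq0 mulr0 !mul0r subr0.
  by move=> /eqP; rewrite oner_eq0.
- transitivity (1 + (1 + t ^+ 2 * p.1 ^+ 2 * p.2 ^+ 2) *
      (t ^+ 2 * p.1 * p.2 * (p.1 * p.2 - q.1 * q.2) -
         (1 - t ^+ 2 * p.1 * q.1 * p.2 * q.2))); first by ring.
  by rewrite n1 z0; ring.
Qed.

(** * Associativity and applicability of the laws *)

(** The inner sums are affine points given by laws [l] and [m]; the outer ones
are compared as ratios, through any laws [e] and [f], so no denominator
condition on them is required.  After clearing the inner denominators each of
the sixteen cases is an identity modulo the three curve equations. *)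
Lemma oplus_assoc_ratio l m e f p q r :
  oncurve p -> oncurve q -> oncurve r ->
  delta t l p q != 0 -> delta t m q r != 0 ->
  same_ratio (xlaw e (oplus t l p q) r) (xlaw f p (oplus t m q r)).
Proof.
move=> /curve_rule e1 /curve_rule e2 /curve_rule e3.
rewrite /delta /oplus; case: ifP => _; case: ifP => _;
  rewrite /delta0 /delta1 !mulf_eq0 !negb_or => /andP[d1 d2] /andP[d3 d4];
  rewrite /same_ratio /xlaw; case: ifP => _; case: ifP => _ /=; apply/eqP;
  move: (t ^+ 2)^-1 t_rule e1 e2 e3 => s ts e1 e2 e3;
  (field: ts e1 e2 e3); by rewrite ?d1 ?d2 ?d3 ?d4.
Qed.

(** Let both laws fail at (p, q) and at (tau p, q), with p = (x1, y1) and
q = (x2, y2).  No coordinate is 0, as otherwise delta_0 = 1.  Failure of law 1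
at the two pairs reads x1 y1 (x2^2 - y2^2) = e x2 y2 (x1^2 - y1^2) for e = 1
and for e = -1, so that x1^2 = y1^2; failure of law 0 at the two pairs reads
t^4 (x1 x2 y1 y2)^2 = 1 and (x1 y1)^2 = (x2 y2)^2, so that t^4 x1^4 y1^4 = 1. *)
Lemma law_applies p q : oncurve p ->
  (exists l, delta t l p q != 0) \/
  [/\ p.1 != 0, p.2 != 0 & exists l, delta t l (tau t p) q != 0].
Proof.
move=> cp.
case: (eqVneq (delta t 0 p q) 0) => [d0|?]; last by left; exists 0.
case: (eqVneq (delta t 1 p q) 0) => [d1|?]; last by left; exists 1.
have : p.1 * p.2 * (q.1 * q.2) != 0.
  apply/eqP => pq0; move/eqP: d0.
  have -> : delta t 0 p q = 1 - (t ^+ 2 * (p.1 * p.2 * (q.1 * q.2))) ^+ 2.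
    by rewrite /delta /delta0 /=; ring.
  by rewrite pq0 mulr0 expr0n subr0 oner_eq0.
rewrite !mulf_eq0 !negb_or => /andP[/andP[p10 p20] /andP[q10 q20]].
right; split=> //.
case: (eqVneq (delta t 0 (tau t p) q) 0) => [d0t|?]; last by exists 0.
case: (eqVneq (delta t 1 (tau t p) q) 0) => [d1t|?]; last by exists 1.
have {}d0t : (p.1 * p.2) ^+ 2 = (q.1 * q.2) ^+ 2.
  apply/eqP; rewrite -subr_eq0; apply/eqP.
  transitivity ((p.1 * p.2) ^+ 2 * delta t 0 (tau t p) q); last by rewrite d0t mulr0.
  by rewrite /delta /delta0 /=; field; rewrite ?t_neq0 ?p10 ?p20.
have {}d1t : (p.1 * q.1 - p.2 * q.2) * (p.1 * q.2 + p.2 * q.1) = 0.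
  transitivity (t ^+ 2 * (p.1 * p.2) ^+ 2 * delta t 1 (tau t p) q);
    last by rewrite d1t mulr0.
  by rewrite /delta /delta1 /=; field; rewrite ?t_neq0 ?p10 ?p20.
rewrite /delta /= /delta0 /delta1 in d0 d1.
case: (no_degenerate_diagonal cp).
- have : 2%:R * (q.1 * q.2) * (p.1 ^+ 2 - p.2 ^+ 2) = 0.
    transitivity ((p.1 * q.1 - p.2 * q.2) * (p.1 * q.2 + p.2 * q.1) -
      (q.1 * p.2 - p.1 * q.2) * (p.1 * q.1 + p.2 * q.2)); first by ring.
    by rewrite d1t d1 subrr.
  move/eqP; rewrite !mulf_eq0 (negPf two_neq0) (negPf q10) (negPf q20) /=.
  by rewrite subr_eq0 => /eqP.
- apply/eqP; rewrite -subr_eq0; apply/eqP.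
  transitivity (t ^+ 4 * (p.1 * p.2) ^+ 2 * ((p.1 * p.2) ^+ 2 - (q.1 * q.2) ^+ 2) -
    (1 - t ^+ 2 * p.1 * q.1 * p.2 * q.2) *
    (1 + t ^+ 2 * p.1 * q.1 * p.2 * q.2)); first by ring.
  by rewrite d0 d0t; ring.
Qed.

(** * The two charts *)

(** The change of chart: a point with abscissa x has, as [P, 1], the
homogeneous coordinate (1 : tx) = flip 1 (x : 1). *)
Definition flip i a : k * k := if i == 0 then a else (a.2, t * a.1).

Lemma same_ratio_flip i a b : same_ratio (flip i a) (flip i b) = same_ratio a b.
Proof.
rewrite /flip; case: ifP => // _; rewrite /same_ratio /= mulrCA -mulrA.
by rewrite (inj_eq (mulfI t_neq0)) eq_sym.
Qed.

Lemma same_ratio_trans b a c :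
  b != (0, 0) -> same_ratio a b -> same_ratio b c -> same_ratio a c.
Proof.
case: a b c => [a1 a2] [b1 b2] [c1 c2]; rewrite /same_ratio xpair_eqE negb_and /=.
move=> b0 /eqP ab /eqP bc; case/orP: b0 => b0; apply/eqP/(mulfI b0).
- transitivity (a1 * (b1 * c2)); first by ring.
  by rewrite bc; transitivity ((a1 * b2) * c1); [ring | rewrite ab; ring].
- transitivity ((a1 * b2) * c2); first by ring.
  by rewrite ab; transitivity (a2 * (b1 * c2)); [ring | rewrite bc; ring].
Qed.

Lemma same_ratio_sym a b : same_ratio a b = same_ratio b a.
Proof. by rewrite /same_ratio eq_sym [a.1 * _]mulrC [a.2 * _]mulrC. Qed.

Lemma flip_neq0 i a : a != (0, 0) -> flip i a != (0, 0).
Proof.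
rewrite /flip; case: ifP => // _; case: a => x z.
by rewrite !xpair_eqE /= mulf_eq0 (negPf t_neq0) andbC.
Qed.

(** tau exchanges the two laws and inverts the coordinates of the result. *)
Lemma xlaw_tau l p q : p.1 != 0 -> p.2 != 0 ->
  exists2 c, c != 0 & xlaw l (tau t p) q =
    (c * (flip 1 (xlaw (l + 1) p q)).1, c * (flip 1 (xlaw (l + 1) p q)).2).
Proof.
move=> p10 p20; case: (F2_cases l) => ->.
- exists ((t * p.1 * p.2)^-1); first by rewrite invr_eq0 !mulf_neq0.
  by rewrite /xlaw /flip /=; congr (_, _); field; rewrite ?t_neq0 ?p10 ?p20.
- exists ((t ^+ 2 * p.1 * p.2)^-1); first by rewrite invr_eq0 !mulf_neq0 ?sqrf_eq0.
  by rewrite /xlaw /flip /=; congr (_, _); field; rewrite ?t_neq0 ?p10 ?p20.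
Qed.

(** As [flip 1] is an involution up to the factor t, the chart bit may be
absorbed: replacing (P, i) by its other representative only permutes the
laws. *)
Lemma same_ratio_tau i l p q a : p.1 != 0 -> p.2 != 0 ->
  same_ratio a (flip (i + 1) (xlaw l (tau t p) q)) =
  same_ratio a (flip i (xlaw (l + 1) p q)).
Proof.
move=> p10 p20; have [c c0 ->] := xlaw_tau l q p10 p20.
move: (xlaw _ _ _) => b; rewrite /same_ratio.
case: (F2_cases i) => ->; rewrite /flip /=.
- by rewrite -[RHS](inj_eq (mulfI (mulf_neq0 c0 t_neq0))); congr (_ == _); ring.
- by rewrite -[RHS](inj_eq (mulfI c0)); congr (_ == _); ring.
Qed.

Lemma rot_tau p : rot (tau t p) = tau t (rot p).
Proof. by rewrite /rot /tau /= mulrN invrN mulrN. Qed.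

Lemma xlawC l p q a i :
  same_ratio a (flip i (xlaw l p q)) = same_ratio a (flip i (xlaw l q p)).
Proof.
rewrite /same_ratio /xlaw /flip; case: ifP => _; case: ifP => _ /=.
- by congr (_ == _); ring.
- by rewrite -[RHS](inj_eq oppr_inj); congr (_ == _); ring.
- by congr (_ == _); ring.
- by rewrite -[RHS](inj_eq oppr_inj); congr (_ == _); ring.
Qed.

Lemma xlaw_rotC l p q : xlaw l (rot p) q = xlaw l (rot q) p.
Proof. by rewrite /xlaw; case: ifP => _ /=; congr (_, _); ring. Qed.

Local Notation point := (Eaff t * 'F_2)%type.
Implicit Types u v w : point.

(** * The graph of the addition *)

(** Equality in P^1 x P^1 of the coordinates of [w] with those given by each of
the two laws.  Both laws are demanded: at any given pair one of them may
degenerate to (0 : 0) and then says nothing. *)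
Definition is_sum u v w : bool :=
  [forall l, same_ratio (flip w.2 ((val w.1).1, 1))
                        (flip (u.2 + v.2) (xlaw l (val u.1) (val v.1)))] &&
  [forall l, same_ratio (flip w.2 ((val w.1).2, 1))
                        (flip (u.2 + v.2) (xlaw l (rot (val u.1)) (val v.1)))].

Lemma Eaff_curve (P : Eaff t) : oncurve (val P).
Proof. exact/eqP/(valP P). Qed.

(** The homogeneous coordinates separate the classes: in the same chart they
give equal points, in different charts the equations t x x' = 1 and t y y' = 1,
which are the gluing. *)
Lemma glue_coord u v :
  same_ratio (flip u.2 ((val u.1).1, 1)) (flip v.2 ((val v.1).1, 1)) ->
  same_ratio (flip u.2 ((val u.1).2, 1)) (flip v.2 ((val v.1).2, 1)) ->
  glue u v.
Proof.
case: u v => [P i] [Q j] /=; case: (eqVneq i j) => [<-|ij].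
  rewrite !same_ratio_flip /same_ratio /= !(mulr1, mul1r) => /eqP x /eqP y.
  apply/orP; left; apply/eqP; congr (_, _); apply/val_inj => /=.
  by rewrite [LHS]surjective_pairing x y -surjective_pairing.
have {ij} -> : j = i + 1.
  case: (F2_cases i) ij => ->; case: (F2_cases j) => -> //=;
    by rewrite ?eqxx // => _; apply/val_inj.
have key x y : same_ratio (flip i (x, 1)) (flip (i + 1) (y, 1)) ->
    x != 0 /\ y = 1 / (t * x).
  have -> : same_ratio (flip i (x, 1)) (flip (i + 1) (y, 1)) = (t * x * y == 1).
    case: (F2_cases i) => ->; rewrite /same_ratio /flip /= ?mulr1.
      by congr (_ == _); ring.
    by rewrite eq_sym.
  move=> /eqP xy; have tx : t * x != 0.
    by apply/eqP => tx; move: xy; rewrite tx mul0r => /esym/eqP; rewrite oner_eq0.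
  split; last by apply: (mulfI tx); rewrite xy mul1r divff.
  by move: tx; rewrite mulf_eq0 negb_or => /andP[].
move=> /key[x0 x] /key[y0 y]; apply/orP; right; apply/and3P; split=> //=.
  exact/andP.
by rewrite /tau -x -y -surjective_pairing.
Qed.

(** Two pairs with proportional ratios have the same sum.  For a single pair
this is uniqueness, and for (P, Q + R) and (P + Q, R) it is associativity. *)
Lemma is_sum_glue u v w u' v' w' : u.2 + v.2 = u'.2 + v'.2 ->
  (forall l m, same_ratio (xlaw l (val u.1) (val v.1)) (xlaw m (val u'.1) (val v'.1))) ->
  (forall l m, same_ratio (xlaw l (rot (val u.1)) (val v.1))
                    (xlaw m (rot (val u'.1)) (val v'.1))) ->
  is_sum u v w -> is_sum u' v' w' -> glue w w'.
Proof.
have key p q p' q' i a b : oncurve p -> oncurve p' ->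
    (forall l m, same_ratio (xlaw l p q) (xlaw m p' q')) ->
    (forall l, same_ratio a (flip i (xlaw l p q))) ->
    (forall l, same_ratio b (flip i (xlaw l p' q'))) -> same_ratio a b.
  move=> cp cp' pp' pa pb.
  have [l l0] := laws_complete q cp; have [m m0] := laws_complete q' cp'.
  apply: (same_ratio_trans (flip_neq0 i l0) (pa l)).
  apply: (@same_ratio_trans (flip i (xlaw m p' q'))); first exact: flip_neq0.
    by rewrite same_ratio_flip.
  by rewrite same_ratio_sym.
move=> uv px py /andP[/forallP wx /forallP wy] /andP[/forallP wx' /forallP wy'].
rewrite -uv in wx' wy'; apply: glue_coord.
  exact: (key _ _ _ _ _ _ _ (Eaff_curve u.1) (Eaff_curve u'.1) px wx wx').
exact: (key _ _ _ _ _ _ _ (rot_curve (Eaff_curve u.1))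
  (rot_curve (Eaff_curve u'.1)) py wy wy').
Qed.

Lemma is_sum_uniq u v w w' : is_sum u v w -> is_sum u v w' -> glue w w'.
Proof.
apply: is_sum_glue => // l m; apply: laws_agree; try exact: Eaff_curve.
exact/rot_curve/Eaff_curve.
Qed.

Lemma is_sumC u v w : is_sum u v w = is_sum v u w.
Proof.
rewrite /is_sum [v.2 + _]addrC; congr (_ && _); apply: eq_forallb => l.
  exact: xlawC.
by rewrite xlaw_rotC.
Qed.

(** Independence of the representative of the first summand. *)
Lemma is_sum_gluel u u' v w : glue u u' -> is_sum u v w -> is_sum u' v w.
Proof.
case/orP => [/eqP-> //|]; case: u u' => [P i] [P' i'].
move=> /and3P[/andP[x0 y0] /eqP /= eP /eqP ->].
rewrite /is_sum /= eP => /andP[/forallP wx /forallP wy].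
rewrite -addrA [1 + _]addrC addrA.
apply/andP; split; apply/forallP => l; rewrite ?rot_tau same_ratio_tau //.
by rewrite oppr_eq0.
Qed.

(** The affine sum satisfies law [l] by construction, and the other law since
the two agree and the ratio of law [l] has a nonzero denominator. *)
Lemma oplus_is_sum l (P Q R : Eaff t) i j : delta t l (val P) (val Q) != 0 ->
  val R = oplus t l (val P) (val Q) -> is_sum (P, i) (Q, j) (R, i + j).
Proof.
rewrite delta_neq0 oplusE => /andP[x0 y0] eR; rewrite /is_sum /= eR /=.
have key p (x : k) m : oncurve p -> x = (xlaw l p (val Q)).1 / (xlaw l p (val Q)).2 ->
    (xlaw l p (val Q)).2 != 0 ->
    same_ratio (flip (i + j) (x, 1)) (flip (i + j) (xlaw m p (val Q))).
  move=> cp ex z0; rewrite same_ratio_flip.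
  apply: (@same_ratio_trans (xlaw l p (val Q))).
  - by move: z0; apply: contra_neq => ->.
  - by rewrite /same_ratio /= ex mul1r divfK.
  - exact: laws_agree (Eaff_curve Q).
apply/andP; split; apply/forallP => m; apply: key => //; first exact: Eaff_curve.
exact/rot_curve/Eaff_curve.
Qed.

(** * The group structure *)

Lemma tau_curve p : oncurve p -> p.1 != 0 -> p.2 != 0 -> oncurve (tau t p).
Proof.
rewrite /oncurve => cp p10 p20.
have -> : edwards_poly t (tau t p).1 (tau t p).2 =
    edwards_poly t p.1 p.2 / (t * p.1 * p.2) ^+ 2.
  by rewrite /edwards_poly /=; field; rewrite ?t_neq0 ?p10 ?p20.
by rewrite cp mul0r.
Qed.

Lemma glue_law_applies u (Q : Eaff t) : exists2 u', glue u u' &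
  exists l, delta t l (val u'.1) (val Q) != 0.
Proof.
case: u => P i.
case: (law_applies (val Q) (Eaff_curve P)) => [lP|[x0 y0 lP]].
  by exists (P, i); first by rewrite /glue eqxx.
have /eqP cP := tau_curve (Eaff_curve P) x0 y0.
exists (exist _ (tau t (val P)) cP, i + 1) => //.
by apply/orP; right; apply/and3P; split=> //; apply/andP.
Qed.

Lemma oplus_point l (P Q : Eaff t) : delta t l (val P) (val Q) != 0 ->
  exists R : Eaff t, val R = oplus t l (val P) (val Q).
Proof.
move=> /(oplus_curve (Eaff_curve P) (Eaff_curve Q)) /eqP cR.
by exists (exist _ (oplus t l (val P) (val Q)) cR).
Qed.

Implicit Types A B C : Ecurve t.

Lemma glueP u v : reflect (\pi_(Ecurve t)%qT u = \pi_(Ecurve t)%qT v) (glue u v).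
Proof. exact: eqmodP. Qed.

Lemma EclsP A : exists P i, A = Ecls P i.
Proof.
by exists (repr A).1, (repr A).2; rewrite /Ecls -surjective_pairing reprK.
Qed.

(** Only the representative of [A] is chosen, that of the other summand being
arbitrary; associativity uses this on both sides of the same point. *)
Lemma add_ruleW A (Q : Eaff t) :
  exists P i l, A = Ecls P i /\ delta t l (val P) (val Q) != 0.
Proof.
have [P [i ->]] := EclsP A.
have [[P' i'] /glueP gP [l dl]] := glue_law_applies (P, i) Q.
by exists P', i', l.
Qed.

Lemma is_sum_exists u v : exists w, is_sum u v w.
Proof.
case: v => Q j; have [P [i [l [eP dl]]]] := add_ruleW (\pi_(Ecurve t)%qT u) Q.
have [R eR] := oplus_point dl.
exists (R, i + j); apply: (@is_sum_gluel (P, i)); last exact: oplus_is_sum eR.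
exact/glueP/esym.
Qed.

Definition edwards_add A B : Ecurve t :=
  \pi_(Ecurve t)%qT (xchoose (is_sum_exists (repr A) (repr B))).

Definition edwards_opp A : Ecurve t := Ecls (Eiota (repr A).1) (repr A).2.

Lemma edwards_addE (P Q R : Eaff t) i j h : is_sum (P, i) (Q, j) (R, h) ->
  edwards_add (Ecls P i) (Ecls Q j) = Ecls R h.
Proof.
move=> PQR; apply/glueP; set v := repr (Ecls Q j).
apply: (@is_sum_uniq (repr (Ecls P i)) v); first exact: xchooseP.
apply: (@is_sum_gluel (P, i)); first by apply/glueP; rewrite reprK.
rewrite is_sumC; apply: (@is_sum_gluel (Q, j)); first by apply/glueP; rewrite reprK.
by rewrite is_sumC.
Qed.

Lemma edwards_add_oplus l (P Q R : Eaff t) i j : delta t l (val P) (val Q) != 0 ->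
  val R = oplus t l (val P) (val Q) ->
  edwards_add (Ecls P i) (Ecls Q j) = Ecls R (i + j).
Proof. by move=> dl eR; apply/edwards_addE/(oplus_is_sum _ _ dl eR). Qed.

Lemma add_ruleP A B C : add_rule A B C <-> C = edwards_add A B.
Proof.
split=> [[P [Q [R [i [j [l [-> -> dl eR ->]]]]]]] | ->].
  exact/esym/(edwards_add_oplus _ _ dl).
have [Q [j ->]] := EclsP B; have [P [i [l [-> dl]]]] := add_ruleW A Q.
have [R eR] := oplus_point dl.
by exists P, Q, R, i, j, l; split=> //; apply: edwards_add_oplus eR.
Qed.

Lemma edwards_oppE (P : Eaff t) i : edwards_opp (Ecls P i) = Ecls (Eiota P) i.
Proof.
rewrite /edwards_opp; set u := repr _.
have : glue (P, i) u by apply/glueP; rewrite reprK.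
case/orP => [/eqP <- //|]; case: u => P' i' /and3P[/andP[x0 y0] /eqP /= eP /eqP ->].
apply/esym/glueP/orP; right; apply/and3P; split=> //=.
  by apply/andP; rewrite /= oppr_eq0.
by rewrite eP /tau /= mulrN invrN mulrN.
Qed.

Lemma edwards_addA : associative edwards_add.
Proof.
move=> A B C; have [Q [j ->]] := EclsP B.
have [P [i [l [-> dPQ]]]] := add_ruleW A Q.
have [R [h [m [-> dRQ]]]] := add_ruleW C Q.
have dQR : delta t m (val Q) (val R) != 0 by rewrite delta_sym.
have [U eU] := oplus_point dPQ; have [V eV] := oplus_point dQR.
rewrite (edwards_add_oplus _ _ dPQ eU) (edwards_add_oplus _ _ dQR eV).
have [[G g] sG] := is_sum_exists (P, i) (V, j + h).
have [[G' g'] sG'] := is_sum_exists (U, i + j) (R, h).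
rewrite (edwards_addE sG) (edwards_addE sG'); apply/glueP.
have cP := Eaff_curve P; have cQ := Eaff_curve Q; have cR := Eaff_curve R.
apply: is_sum_glue sG sG'; rewrite /= ?addrA // => e f; rewrite same_ratio_sym eU eV.
  exact: oplus_assoc_ratio.
by rewrite rot_oplus; apply: oplus_assoc_ratio; rewrite ?delta_rot //; apply: rot_curve.
Qed.

Lemma edwards_addC : commutative edwards_add.
Proof.
move=> A B; have [P [i ->]] := EclsP A; have [Q [j ->]] := EclsP B.
have [[R h] PQR] := is_sum_exists (P, i) (Q, j).
by rewrite (edwards_addE PQR); apply/esym/edwards_addE; rewrite is_sumC.
Qed.

Lemma edwards_add0 : left_id (Ecls (one0 t) 0) edwards_add.
Proof.
move=> A; have [P [i ->]] := EclsP A; rewrite -[i in RHS]add0r.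
apply: (@edwards_add_oplus 0); rewrite /delta /oplus /= /delta0 /oplus0 /=.
  by rewrite !(mulr0, mul0r) subr0 addr0 mulr1 oner_neq0.
rewrite !(mulr0, mul0r, mul1r, subr0, addr0, divr1).
exact: surjective_pairing.
Qed.

(** No single law applies at all the pairs (iota P, P), but both ratios are
right throughout: for the abscissa the numerator equals the denominator, by the
curve equation in the case of law 0, and for the ordinate the numerator
is 0. *)
Lemma edwards_addN : left_inverse (Ecls (one0 t) 0) edwards_opp edwards_add.
Proof.
move=> A; have [P [i ->]] := EclsP A; rewrite edwards_oppE; apply: edwards_addE.
have := Eaff_curve P; rewrite /oncurve /edwards_poly.
have ii : i + i = 0 by case: (F2_cases i) => ->; apply/val_inj.
rewrite /is_sum /= ii; move: (sval P) => [x y] /= cP.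
apply/andP; split; apply/forallP => l; apply/eqP.
  rewrite /xlaw /flip /=; case: ifP => _ /=; last by ring.
  by apply/eqP; rewrite -subr_eq0 -oppr_eq0; apply/eqP; rewrite -[RHS]cP; ring.
by rewrite /xlaw /flip /=; case: ifP => _ /=; ring.
Qed.

End Laws.

Theorem theorem2 (k : fieldType) (t : k)
    (hchar : 2%N \notin [pchar k]) (ht0 : t != 0) (ht1 : t ^+ 2 != 1) :
  (forall (P Q : Eaff t) (l : 'F_2), delta t l (val P) (val Q) != 0 ->
     edwards_poly t (oplus t l (val P) (val Q)).1
                    (oplus t l (val P) (val Q)).2 = 0) /\
  exists (add : Ecurve t -> Ecurve t -> Ecurve t) (opp : Ecurve t -> Ecurve t),
    [/\ forall a b c : Ecurve t, add_rule a b c <-> c = add a b,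
        forall (P : Eaff t) (i : 'F_2), opp (Ecls P i) = Ecls (Eiota P) i
      & [/\ associative add, commutative add,
            left_id (Ecls (one0 t) 0) add
          & left_inverse (Ecls (one0 t) 0) opp add]].
Proof.
split=> [P Q l|]; first exact: (oplus_curve ht0 (Eaff_curve P) (Eaff_curve Q)).
exists (edwards_add hchar ht0 ht1), (@edwards_opp k t); split.
- exact: add_ruleP.
- exact: edwards_oppE.
split; [exact: edwards_addA | exact: edwards_addC | exact: edwards_add0 |].
exact: edwards_addN.
Qed.
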